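(* Let $d\ge1$, $s\in\{1,\dots,d\}$, and let $f:[0,1]^d\to\mathbb{R}$ be such that the partial derivative $f^{(\mathbf p)}$ exists and is continuous on $[0,1]^d$ for every $\mathbf p=(p_1,\dots,p_d)\in\{0,1,2\}^d$. Then $f\in\mathcal{F}^d_{\mathrm{TC}}$ if $f^{(\mathbf p)}\le0$ for all $\mathbf p\in\{0,1,2\}^d$ with $\max_jp_j=2$. If, in addition, $f^{(\mathbf p)}=0$ for all $\mathbf p\in\{0,1\}^d$ with $\sum_jp_j>s$, then $f\in\mathcal{F}^{d,s}_{\mathrm{TC}}$.
   Context: $f^{(\mathbf p)}=\dfrac{\partial^{p_1+\cdots+p_d}f}{\partial x_1^{p_1}\cdots\partial x_d^{p_d}}$. $[d]=\{1,\dots,d\}$, $\mathbf 0=(0,\dots,0)$, $(x)_+=\max(x,0)$. $\mathcal{F}^{d,s}_{\mathrm{TC}}$ is the class of all functions $f:[0,1]^d\to\mathbb{R}$ of the form $$f(x_1,\dots,x_d)=\beta_0+\sum_{S:1\le|S|\le s}\beta_S\prod_{j\in S}x_j-\sum_{S:1\le|S|\le s}\int_{[0,1)^{|S|}\setminus\{\mathbf 0\}}\prod_{j\in S}(x_j-t_j)_+\,d\nu_S(t_j,j\in S),$$ where $S$ ranges over subsets of $[d]$, $\beta_0,\beta_S\in\mathbb{R}$ and each $\nu_S$ is a finite (nonnegative) Borel measure on $[0,1)^{|S|}\setminus\{\mathbf 0\}$. Also $\mathcal{F}^d_{\mathrm{TC}}:=\mathcal{F}^{d,d}_{\mathrm{TC}}$.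 *)

(* Defs.v *)
From HB Require Import structures.
From mathcomp Require Export all_boot all_order all_algebra.
From mathcomp Require Export all_classical all_reals all_analysis.
Export Order.TTheory GRing.Theory Num.Theory.
Export numFieldNormedType.Exports.

Set Implicit Arguments.
Unset Strict Implicit.
Unset Printing Implicit Defensive.

Local Open Scope classical_set_scope.
Local Open Scope ring_scope.

(* A function on [0,1]^d is a function on 'rV[R]_d of which only the values on
   the cube are ever used. *)
Definition unit_cube (R : realType) (d : nat) : set 'rV[R]_d :=
  [set x | forall j : 'I_d, 0 <= x ord0 j <= 1].

(* The increments h keep x + h e_j in the cube, so the derivative is two-sided
   when 0 < x_j < 1 and one-sided on the faces x_j = 0 and x_j = 1. *)
Definition increments (R : realType) (d : nat) (j : 'I_d) (x : 'rV[R]_d) :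
    set_system R :=
  within [set h : R | unit_cube (x + h *: delta_mx ord0 j)] (0 : R)^'.

Definition diff_quotient (R : realType) (d : nat) (j : 'I_d)
    (f : 'rV[R]_d -> R) (x : 'rV[R]_d) (h : R) : R :=
  (f (x + h *: delta_mx ord0 j) - f x) / h.

Definition partial_derivable (R : realType) (d : nat) (j : 'I_d)
    (f : 'rV[R]_d -> R) : Prop :=
  forall x, unit_cube x -> cvg (diff_quotient j f x h @[h --> increments j x]).

(* Meaningful for x in the cube, provided partial_derivable j f holds. *)
Definition partial_deriv (R : realType) (d : nat) (j : 'I_d)
    (f : 'rV[R]_d -> R) : 'rV[R]_d -> R :=
  fun x => lim (diff_quotient j f x h @[h --> increments j x]).

(* The head of the list is the outermost derivative, i.e. the last one taken. *)
Definition iter_deriv (R : realType) (d : nat) (js : seq 'I_d)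
    (f : 'rV[R]_d -> R) : 'rV[R]_d -> R :=
  foldr (@partial_deriv R d) f js.

Fixpoint iter_derivable (R : realType) (d : nat) (js : seq 'I_d)
    (f : 'rV[R]_d -> R) : Prop :=
  if js is j :: js' then
    iter_derivable js' f /\ partial_derivable j (iter_deriv js' f)
  else True.

(* Lists each j exactly p_j times, in increasing order: this is the order of
   differentiation in d^{|p|} f / (dx_1^{p_1} ... dx_d^{p_d}), where d/dx_d acts
   first and d/dx_1 last. *)
Definition directions (d : nat) (p : {ffun 'I_d -> 'I_3}) : seq 'I_d :=
  flatten [seq nseq (p j) j | j <- enum 'I_d].

Definition mixed_derivable (R : realType) (d : nat) (p : {ffun 'I_d -> 'I_3})
    (f : 'rV[R]_d -> R) : Prop :=
  iter_derivable (directions p) f.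

Definition mixed_deriv (R : realType) (d : nat) (p : {ffun 'I_d -> 'I_3})
    (f : 'rV[R]_d -> R) : 'rV[R]_d -> R :=
  iter_deriv (directions p) f.

(* [0,1)^n \ {0}. The library's sigma-algebra on n.-tuple (measurableTypeR R) is
   generated by the coordinate maps, i.e. it is the Borel sigma-algebra of R^n. *)
Definition punctured_cube (R : realType) (n : nat) :
    set (n.-tuple (measurableTypeR R)) :=
  [set t | (forall i : 'I_n, 0 <= (tnth t i : R) < 1) /\
           (exists i : 'I_n, (tnth t i : R) != 0)].

(* prod_{j in S} (x_j - t_j)_+, where the coordinates of t are indexed by the
   increasing enumeration enum_val of S. *)
Definition hinge_product (R : realType) (d : nat) (S : {set 'I_d})
    (x : 'rV[R]_d) (t : #|S|.-tuple (measurableTypeR R)) : R :=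
  \prod_(i < #|S|) Num.max (x ord0 (enum_val i) - (tnth t i : R)) 0.

(* The class F_TC^{d,s}. A finite Borel measure on [0,1)^{|S|} \ {0} is encoded
   as a finite Borel measure on R^{|S|} that vanishes off that set; nu S is
   irrelevant unless 1 <= |S| <= s. *)
Definition F_TC (R : realType) (d s : nat) (f : 'rV[R]_d -> R) : Prop :=
  exists (beta0 : R) (beta : {set 'I_d} -> R)
    (nu : forall S : {set 'I_d},
      {finite_measure set (#|S|.-tuple (measurableTypeR R)) -> \bar R}),
    (forall S : {set 'I_d}, nu S (~` @punctured_cube R #|S|) = 0%E) /\
    forall x : 'rV[R]_d, unit_cube x ->
      f x = beta0
        + \sum_(S : {set 'I_d} | (1 <= #|S| <= s)%N)
            beta S * \prod_(j in S) x ord0 j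
        - \sum_(S : {set 'I_d} | (1 <= #|S| <= s)%N)
            \int[nu S]_(t in @punctured_cube R #|S|) hinge_product x t.

(* Main.v *)
(** Expand [f] by Taylor's formula with integral remainder of order two at [0],
    one coordinate at a time from the last to the first, i.e. in the order in
    which the mixed derivatives are taken:
    [g(x_j) = g(0) + x_j g'(0) + \int_0^1 (x_j - u)_+ g''(u) du].
    After all [d] coordinates, [f x] is the sum over [p] in [{0,1,2}^d] of the
    expectation of [\prod_(j | p_j != 0) (x_j - z_j)_+ * f^(p)(z)], where
      [z_j] is
    uniform on [(0,1)] if [p_j = 2] and [z_j = 0] otherwise.  Group the terms by
    the support [S] of [p].  The order [p = 1_S] gives the monomial
    [beta_S \prod_(j in S) x_j]; every other [p] has an entry equal to [2], so
    [-f^(p) >= 0], and the law of [z] with density [-f^(p)] contributes to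
      [nu_S].

    For the second claim, the sum [V_S] of the terms of support [S] depends only
    on the coordinates in [S] and vanishes when one of them does, so [V_S] is
    recovered from [f] by composing the differences
    [h(x) - h(x with x_j := 0)], [j] in [S].  When [f^(1_S) = 0] these
    differences kill [f], one derivative being traded for one difference at a
    time; hence [V_S = 0] for [|S| > s], without any interchange of
      derivatives. *)

From HB Require Import structures.
Require Import Defs.
From mathcomp Require Import measurable_realfun ring lra.
Local Open Scope classical_set_scope.
Local Open Scope ring_scope.

Set Implicit Arguments.
Unset Strict Implicit.
Unset Printing Implicit Defensive.

(** * Slices of the cube *)

Local Open Scope classical_set_scope.
Local Open Scope ring_scope.

Section Upd.
Context {R : realType} {d : nat}.
Implicit Types (x : 'rV[R]_d) (i j : 'I_d) (u v : R) (f g : 'rV[R]_d -> R).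

Definition upd x j u : 'rV[R]_d :=
  \row_i (if i == j then u else x ord0 i).

Lemma updE x j u i : upd x j u ord0 i = if i == j then u else x ord0 i.
Proof. by rewrite mxE. Qed.

Lemma upd_id x j : upd x j (x ord0 j) = x.
Proof. by apply/rowP => i; rewrite updE; case: eqP => [->|]. Qed.

Lemma upd_upd x j u v : upd (upd x j u) j v = upd x j v.
Proof. by apply/rowP => i; rewrite !updE; case: eqP. Qed.

Lemma updC x i j u v : i != j -> upd (upd x i u) j v = upd (upd x j v) i u.
Proof.
move=> ij; apply/rowP => k; rewrite !updE.
by case: (k =P j) => [->|//]; rewrite eq_sym (negbTE ij).
Qed.

Lemma add_delta_upd x j h : x + h *: delta_mx ord0 j = upd x j (x ord0 j + h).
Proof.
apply/rowP => i; rewrite updE !mxE eqxx /=; case: eqP => [->|_].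
  by rewrite mulr1.
by rewrite mulr0 addr0.
Qed.

Lemma unit_cube_upd x j u : unit_cube x -> 0 <= u <= 1 -> unit_cube (upd x j u).
Proof. by move=> xc uc i; rewrite updE; case: eqP. Qed.

Lemma unit_cube_updE x j u :
  unit_cube x -> unit_cube (upd x j u) <-> 0 <= u <= 1.
Proof.
move=> xc; split; last exact: unit_cube_upd.
by move=> /(_ j); rewrite updE eqxx.
Qed.

(** Admissible increments depend on [x] only through its coordinate [j]. Hence moving another
    coordinate leaves the filter unchanged, which lets differences in one direction commute with
    derivatives in another. *)
Lemma incrementsE x j : unit_cube x ->
  increments j x = within [set h : R | 0 <= x ord0 j + h <= 1] (0 : R)^'.
Proof.
move=> xc; rewrite /increments.
suff -> : [set h | unit_cube (x + h *: delta_mx ord0 j)] =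
  [set h : R | 0 <= x ord0 j + h <= 1] by [].
apply/seteqP; split => h /=; rewrite add_delta_upd.
  by move/unit_cube_updE; exact.
by move=> ?; exact/unit_cube_updE.
Qed.

(** Properness makes limits along the increments unique, so a limit that has been computed is the
    value of [partial_deriv]. Each point of [0,1] has room at least 1/2 on one side: this gives the
    bound 1/2 in [m] and the choice of sign. *)
Lemma increments_proper x j : unit_cube x -> ProperFilter (increments j x).
Proof.
move=> xc; apply: Build_ProperFilter_ex => A;
  rewrite incrementsE // => -[e /= e0 eA].
have /andP[x0 x1] := xc j.
set m := Num.min (e / 2) (1 / 2).
have m0 : 0 < m by rewrite lt_min !divr_gt0.
have me : m < e by rewrite gt_min; apply/orP; left; lra.
have m12 : m <= 1 / 2 by rewrite ge_min lexx orbT.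
have [xj|xj] := leP (x ord0 j) (1 / 2).
  exists m; have := eA m; rewrite /ball_ /= sub0r normrN gtr0_norm // gt_eqF //.
  by apply => //; lra.
exists (- m); have := eA (- m).
rewrite /ball_ /= sub0r normrN normrN gtr0_norm // lt_eqF ?oppr_lt0 //.
by apply => //; lra.
Qed.

Lemma diff_quotientE j f x h :
  diff_quotient j f x h = (f (upd x j (x ord0 j + h)) - f x) / h.
Proof. by rewrite /diff_quotient add_delta_upd. Qed.

Lemma partial_derivP j f x : partial_derivable j f -> unit_cube x ->
  diff_quotient j f x h @[h --> increments j x] --> partial_deriv j f x.
Proof. by move=> df xc; exact: df. Qed.

Lemma line_continuous j f x : {within @unit_cube R d, continuous f} ->
  unit_cube x -> {within `[0, 1], continuous (fun u => f (upd x j u))}.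
Proof.
move=> cf xc; apply/subspace_continuousP => u u01.
have uc : unit_cube (upd x j u) by apply: unit_cube_upd.
move/subspace_continuousP : cf => /(_ _ uc).
apply: cvg_comp => B /= wB.
have cu : {for u, continuous (fun v => upd x j v)}.
  rewrite (_ : (fun v => upd x j v) =
    fun v => upd x j 0 + v *: delta_mx ord0 j); last first.
    by apply/funext => v; rewrite add_delta_upd upd_upd updE eqxx add0r.
  by apply: cvgD; [exact: cvg_cst|apply: cvgZr_tmp; exact: cvg_id].
have := cu _ wB; rewrite /within /= !nbhs_simpl /=.
by apply: filterS => v /= vB v01; apply: vB; exact: unit_cube_upd.
Qed.

(** Off the two faces, small increments stay in the cube, so the constraint in [increments]
    disappears and the derivative is the usual two-sided one. *)
Lemma line_is_derive j f x u : partial_derivable j f -> unit_cube x ->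
  0 < u < 1 ->
  is_derive u 1 (fun v => f (upd x j v)) (partial_deriv j f (upd x j u)).
Proof.
move=> df xc /andP[u0 u1].
have uc : unit_cube (upd x j u) by apply: unit_cube_upd => //; rewrite !ltW.
have := partial_derivP df uc; rewrite incrementsE // updE eqxx => H.
suff : h^-1 *: (f (upd x j (h *: 1 + u)) - f (upd x j u)) @[h --> 0^'] -->
    partial_deriv j f (upd x j u).
  move=> K; apply: DeriveDef; first by apply/cvg_ex;
    exists (partial_deriv j f (upd x j u)).
  exact/cvg_lim.
have -> : (fun h => h^-1 *: (f (upd x j (h *: 1 + u)) - f (upd x j u))) =
    diff_quotient j f (upd x j u).
  apply/funext => h; rewrite diff_quotientE upd_upd updE eqxx.
  by rewrite /GRing.scale /= mulr1 (addrC h) mulrC.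
apply: cvg_trans H; apply: cvg_app.
move=> P /= ; rewrite /within /= => -[e /= e0 He].
exists (Num.min e (Num.min u (1 - u))) => /=.
  by rewrite !lt_min e0 u0 subr_gt0.
move=> h /=; rewrite sub0r normrN !lt_min => /and3P[he hu hu1] h0.
have := He h; rewrite /= sub0r normrN; apply => //.
by move: hu hu1; rewrite !ltr_norml => /andP[? ?] /andP[? ?]; lra.
Qed.
End Upd.

(** * Bounded measurable functions and the one-dimensional Taylor formula *)

(** This class is stable under the operations below and integrable for every finite measure, so the
    integrability conditions on sampled integrands reduce to membership in it. *)
Definition bounded_measurable (R : realType) (dT : measure_display)
    (T : measurableType dT) (h : T -> R) : Prop :=
  measurable_fun [set: T] h /\ exists M, forall t, `|h t| <= M.

Section BoundedMeasurable.
Context {R : realType} {dT : measure_display} {T : measurableType dT}.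
Implicit Types h k : T -> R.

Lemma bounded_measurable_cst c : bounded_measurable (fun _ : T => c : R).
Proof. by split; [exact: measurable_cst|exists `|c|]. Qed.

Lemma bounded_measurableD h k : bounded_measurable h -> bounded_measurable k ->
  bounded_measurable (fun t => h t + k t).
Proof.
move=> [mh [M hM]] [mk [N kN]]; split; first exact: measurable_funD.
by exists (M + N) => t; rewrite (le_trans (ler_normD _ _)) // lerD.
Qed.

Lemma bounded_measurableM h k : bounded_measurable h -> bounded_measurable k ->
  bounded_measurable (fun t => h t * k t).
Proof.
move=> [mh [M hM]] [mk [N kN]]; split; first exact: measurable_funM.
by exists (M * N) => t; rewrite normrM ler_pM.
Qed.

Lemma bounded_measurableN h : bounded_measurable h ->
  bounded_measurable (fun t => - h t).
Proof.
move=> [mh [M hM]]; split; first exact: measurableT_comp.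
by exists M => t; rewrite normrN.
Qed.

Lemma bounded_measurable_prod (I : Type) (r : seq I) (P : pred I)
    (h : I -> T -> R) : (forall i, bounded_measurable (h i)) ->
  bounded_measurable (fun t => \prod_(i <- r | P i) h i t).
Proof.
move=> mh; elim: r => [|i r IH].
  by under eq_fun do rewrite big_nil; exact: bounded_measurable_cst.
under eq_fun do rewrite big_cons.
by case: (P i) => //; exact: bounded_measurableM.
Qed.

Lemma bounded_measurable_integrable (mu : {finite_measure set T -> \bar R})
    (A : set T) h : measurable A -> bounded_measurable h ->
  mu.-integrable A (EFin \o h).
Proof.
move=> mA [mh [M hM]]; apply: measurable_bounded_integrable => //.
- by rewrite ltey_eq fin_num_measure.
- exact: measurable_funTS.
- exists M; split; first exact: num_real.
  by move=> N MN t _; apply: (le_trans (hM t)); exact: ltW.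
Qed.

Lemma Rintegral_sum (mu : {finite_measure set T -> \bar R}) (I : Type)
    (r : seq I) (P : pred I) (h : I -> T -> R) :
  (forall i, bounded_measurable (h i)) ->
  \int[mu]_t (\sum_(i <- r | P i) h i t) = \sum_(i <- r | P i) \int[mu]_t h i t.
Proof.
move=> mh; elim: r => [|i r IH].
  under eq_Rintegral do rewrite big_nil.
  by rewrite big_nil Rintegral_cst // mul0r.
under eq_Rintegral do rewrite big_cons.
rewrite big_cons; case: (P i) => //; rewrite RintegralD // ?IH //.
  exact: bounded_measurable_integrable.
apply: bounded_measurable_integrable => // {IH}.
elim: r => [|j r IH]; first by under eq_fun do rewrite big_nil; exact:
  bounded_measurable_cst.
by under eq_fun do rewrite big_cons; case: (P j) => //; exact:
  bounded_measurableD.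
Qed.

Lemma Rintegral_probability_cst (mu : probability T R) c :
  \int[mu]_(_ in [set: T]) c = c.
Proof.
rewrite Rintegral_cst // -[RHS]mulr1 -[1]/(fine 1%E).
by congr (_ * fine _); exact: probability_setT.
Qed.

End BoundedMeasurable.

Lemma bounded_measurable_comp (R : realType) d1 d2 (T1 : measurableType d1)
    (T2 : measurableType d2) (phi : T1 -> T2) (h : T2 -> R) :
  measurable_fun [set: T1] phi -> bounded_measurable h ->
  bounded_measurable (fun t => h (phi t)).
Proof.
move=> mphi [mh [M hM]]; split; last by exists M.
exact: (measurableT_comp mh mphi).
Qed.

Section Taylor.
Context {R : realType}.
Notation leb := (@lebesgue_measure R).

(** With a probability, a term that does not depend on the sample equals its own integral, so Taylor
    terms of all orders become integrals over one space. *)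
Definition unif01 : probability (measurableTypeR R) R :=
  @uniform_prob R 0 1 ltr01.

(* Makes the samples lie in (0,1) everywhere, not only almost surely: every
   argument of f^(p) is in the cube and nu_S vanishes off the punctured cube. *)
Definition retract01 (u : R) : R := if 0 < u < 1 then u else 1 / 2.

Lemma retract01_bounds u : 0 < retract01 u < 1.
Proof. by rewrite /retract01; case: ifP => // _; lra. Qed.

Lemma measurable_retract01 : measurable_fun [set: measurableTypeR R] retract01.
Proof.
apply: measurable_fun_ifT => //=.
by apply: measurable_and; exact: measurable_fun_ltr.
Qed.

(** The formula for the uniform law is applied to the nonnegative function [h + M], then the
    constant [M] is cancelled on both sides. *)
Lemma Rintegral_unif01 (h : R -> R) :
  bounded_measurable (h : measurableTypeR R -> R) ->
  \int[unif01]_u h u = \int[leb]_(u in `[0, 1]) h u.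
Proof.
move=> mh; have [_ [M hM]] := mh.
have leb01 : leb `[0%R, 1%R] = 1%E.
  by rewrite lebesgue_measure_itv /= lte_fin ltr01 -EFinB subr0.
have ge0 : \int[unif01]_u (h u + M) = \int[leb]_(u in `[0, 1]) (h u + M).
  rewrite /Rintegral /unif01 integral_uniform.
  - by rewrite subr0 invr1 mul1e.
  - apply/measurable_EFinP.
    by have [] := bounded_measurableD mh (bounded_measurable_cst M).
  - by move=> u; rewrite lee_fin -lerBlDr sub0r; have := hM u;
    rewrite ler_norml => /andP[].
have I1 : leb.-integrable `[0, 1] (EFin \o h).
  have [mh' _] := mh.
  apply: measurable_bounded_integrable => //.
  - by change (leb `[0%R, 1%R] < +oo)%E; rewrite leb01 ltry.
  - exact: measurable_funTS.
  - exists M; split; first exact: num_real.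
    by move=> N MN t _; apply: (le_trans (hM t)); exact: ltW.
have I2 : leb.-integrable `[0, 1] (EFin \o (fun=> M)).
  apply: measurable_bounded_integrable => //.
  - by change (leb `[0%R, 1%R] < +oo)%E; rewrite leb01 ltry.
  - exists `|M|; split; first exact: num_real.
    by move=> N MN t _; exact: ltW.
move: ge0; rewrite RintegralD //; last 2 first.
- exact: bounded_measurable_integrable.
- by apply: bounded_measurable_integrable => //; exact: bounded_measurable_cst.
rewrite RintegralD // Rintegral_probability_cst.
have -> : \int[leb]_(u in `[0, 1]) M = M.
  rewrite Rintegral_cst // -[RHS]mulr1 -[1 in RHS]/(fine 1%E).
  by congr (_ * fine _); exact: leb01.
by move/addIr.
Qed.

(** The hinge vanishes beyond [v], which reduces the integral to [0, v]; there the fundamental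
    theorem of calculus applies to an explicit primitive. *)
Lemma taylor_interval (g g1 g2 : R -> R) (v : R) :
  {within `[0, 1], continuous g} -> {within `[0, 1], continuous g1} ->
  {within `[0, 1], continuous g2} ->
  (forall u : R, 0 < u < 1 -> is_derive u 1 g (g1 u)) ->
  (forall u : R, 0 < u < 1 -> is_derive u 1 g1 (g2 u)) ->
  0 <= v <= 1 ->
  g v = g 0 + v * g1 0 + \int[leb]_(u in `[0, 1]) (Num.max (v - u) 0 * g2 u).
Proof.
move=> cg cg1 cg2 dg dg1 /andP[v0 v1].
have -> : \int[leb]_(u in `[0, 1]) (Num.max (v - u) 0 * g2 u) =
    \int[leb]_(u in `[0, v]) ((v - u) * g2 u).
  have -> : `[0, v]%classic = `[0, 1]%classic `&` [set u : R | u <= v].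
    apply/seteqP; split => u /=; rewrite !in_itv /=.
      by move=> /andP[-> uv]; rewrite uv (le_trans uv v1).
    by move=> [/andP[-> _] ->].
  rewrite Rintegral_mkcondr; apply: eq_Rintegral => u _.
  rewrite patchE; case: ifPn => [|]; first by rewrite inE /= => uv;
    rewrite max_l // subr_ge0.
  by rewrite notin_setE /= => /negP; rewrite -ltNge => vu;
    rewrite max_r ?mul0r // subr_le0 ltW.
(* The fundamental theorem needs a nondegenerate interval, so [v = 0] is treated apart. *)
move: v0; rewrite le_eqVlt => /predU1P[<-|v0].
  by rewrite mul0r addr0 set_itv1 Rintegral_set1 addr0.
(* Phi' = (v - u) g2, since the terms in g1 cancel. *)
pose Phi u := (v - u) * g1 u + g u.
have sub : `[0, v] `<=` `[0, 1]%classic.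
  by move=> u /=; rewrite !in_itv /= => /andP[-> uv]; rewrite (le_trans uv v1).
have cPhi : {within `[0, v], continuous Phi}.
  move=> u; apply: cvgD; last exact: (continuous_subspaceW sub cg).
  apply: cvgM; last exact: (continuous_subspaceW sub cg1).
  apply: cvgB; first exact: cvg_cst.
  by apply: (@continuous_subspaceT _ _ _ id) => t; exact: cvg_id.
have ch : {within `[0, v], continuous (fun u => (v - u) * g2 u)}.
  move=> u; apply: cvgM; last exact: (continuous_subspaceW sub cg2).
  apply: cvgB; first exact: cvg_cst.
  by apply: (@continuous_subspaceT _ _ _ id) => t; exact: cvg_id.
have dPhi u : 0 < u < v -> is_derive u 1 Phi ((v - u) * g2 u).
  move=> /andP[u0 uv]; have u01 : 0 < u < 1 by rewrite u0 (lt_le_trans uv v1).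
  have d1 := dg _ u01; have d2 := dg1 _ u01.
  apply: is_derive_eq.
  by rewrite /GRing.scale /=; ring.
have [_ P0 Pv] := (continuous_within_itvP _ v0).1 cPhi.
have := @continuous_FTC2 R (fun u => (v - u) * g2 u) Phi 0 v v0 ch.
rewrite /Rintegral => -> /=.
- by rewrite /Phi subrr mul0r add0r subr0; ring.
- by split => // u; rewrite in_itv /= => /dPhi [].
- by move=> u; rewrite in_itv /= => /dPhi d; rewrite derive1E; exact:
  derive_val.
Qed.

End Taylor.

(** * Measurability of continuous functions on the cube *)

Section CubeMeasurable.
Context {R : realType} {d : nat}.
Implicit Types g : 'rV[R]_d -> R.

Lemma continuous_cube_bounded g : {within @unit_cube R d, continuous g} ->
  exists M, forall x, unit_cube x -> `|g x| <= M.
Proof.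
move=> cg.
have /(continuous_compact cg) : compact (@unit_cube R d).
  have := @rV_compact R d (fun=> `[0, 1]%classic) (fun=> @segment_compact R 0
    1).
  congr compact; apply/seteqP; split => x /= xc i; have := xc i; by
    rewrite in_itv.
move=> /compact_bounded [M [_ hM]]; exists (M + 1) => x xc.
by apply: hM; [rewrite ltrDl|exists x].
Qed.

Lemma dist_truncn (N : nat) (y : R) : 0 <= y ->
  let k := Num.truncn (N.+1%:R * y) in
  k%:R / N.+1%:R <= y /\ y - k%:R / N.+1%:R < N.+1%:R^-1.
Proof.
move=> y0 k; have /andP[k1 k2] : k%:R <= N.+1%:R * y < k.+1%:R.
  by rewrite -truncn_eq ?mulr_ge0.
rewrite ler_pdivrMr // mulrC; split => //.
by rewrite ltrBlDl -[X in _ + X]mul1r -mulrDl natr1 ltr_pdivlMr // mulrC.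
Qed.

Context {dT : measure_display} {T : measurableType dT}.

(* Rounding every coordinate down to the grid of mesh 1/(N+1) stays in the cube
   and gives finitely-valued measurable functions converging pointwise. *)
Lemma bounded_measurable_cube g (y : T -> 'rV[R]_d) :
  {within @unit_cube R d, continuous g} ->
  (forall i, measurable_fun [set: T] (fun t => y t ord0 i)) ->
  (forall t, unit_cube (y t)) -> bounded_measurable (fun t => g (y t)).
Proof.
move=> cg my yc; split; last first.
  by have [M hM] := continuous_cube_bounded cg; exists M => t; exact: hM.
pose k N t i := Num.truncn (N.+1%:R * y t ord0 i).
pose q N t : 'rV[R]_d := \row_i ((k N t i)%:R / N.+1%:R).
apply: (@measurable_fun_cvg _ _ _ _ (fun N t => g (q N t))); last first.
  move=> t _.
  have /subspace_continuousP /(_ _ (yc t)) := cg.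
  apply: cvg_comp => B /= wB.
  move: wB; rewrite /within /= => /nbhs_ballP [e /= e0 He].
  have [N0 _ HN] := near_infty_natSinv_lt (PosNum e0).
  exists N0 => // N /= /HN /= Ne; apply: He; last first.
    move=> i; rewrite mxE; have /andP[y0 y1] := yc t i.
    have [k1 k2] := dist_truncn N y0.
    by rewrite (le_trans k1 y1) andbT divr_ge0.
  split => // a i; rewrite (ord1 a) /ball /= mxE.
  have /andP[y0 y1] := yc t i; have [k1 k2] := dist_truncn N y0.
  by rewrite ger0_norm ?subr_ge0 // (lt_trans k2).
move=> N.
(* The coordinate 1 is rounded to the index N + 1, hence N + 2 grid values per coordinate. *)
have kle t i : (k N t i < N.+2)%N.
  have /andP[y0 y1] := yc t i.
  have [k1 _] := dist_truncn N y0.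
  by rewrite ltnS -(ler_nat R) -[leRHS]mul1r -ler_pdivrMr // (le_trans k1 y1).
pose pt (phi : {ffun 'I_d -> 'I_N.+2}) : 'rV[R]_d :=
  \row_i ((phi i : nat)%:R / N.+1%:R).
(* The rounded function is a finite combination of indicators of grid cells; for each [t] only the
   cell [phi0] contributes. *)
have -> : (fun t => g (q N t)) = (fun t => \sum_(phi : {ffun 'I_d -> 'I_N.+2})
    g (pt phi) * \prod_(i < d) (k N t i == phi i)%:R).
  apply/funext => t; pose phi0 : {ffun 'I_d -> 'I_N.+2} :=
    [ffun i => Ordinal (kle t i)].
  rewrite (bigD1 phi0) //= [X in _ * X]big1 ?mulr1; last first.
    by move=> i _; rewrite ffunE eqxx.
  rewrite big1 ?addr0; last first.
    move=> phi phiN; have /existsP[i ik] : [exists i, phi i != phi0 i].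
      rewrite -negb_forall; apply: contra phiN => /forallP H.
      by apply/eqP/ffunP => i; exact/eqP.
    rewrite (bigD1 i) //= (_ : _ == _ = false) ?mul0r ?mulr0 //.
    apply: contraNF ik => /eqP ki; apply/eqP/val_inj.
    by rewrite ffunE /= ki.
  by congr g; apply/rowP => i; rewrite !mxE ffunE.
apply: measurable_sum => phi; apply: measurable_funM; first exact:
  measurable_cst.
apply: measurable_prod => i _.
have -> : (fun t => (k N t i == phi i)%:R : R) =
    (fun t => if ((phi i : nat)%:R <= N.+1%:R * y t ord0 i) &&
       (N.+1%:R * y t ord0 i < (phi i : nat).+1%:R) then 1 else 0).
  apply/funext => t; have /andP[y0 _] := yc t i.
  by rewrite truncn_eq ?mulr_ge0 //; case: ifP.
have mN : measurable_fun [set: T] (fun t => N.+1%:R * y t ord0 i).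
  by apply: measurable_funM.
apply: measurable_fun_ifT => //.
by apply: measurable_and; [exact: measurable_fun_ler|exact: measurable_fun_ltr].
Qed.

End CubeMeasurable.

(** * Taylor's formula along a line of the cube *)

Lemma measurable_retract01_upd (R : realType) d (x : 'rV[R]_d) j i :
  measurable_fun [set: measurableTypeR R] (fun u => upd x j (retract01 u) ord0
    i).
Proof.
under eq_fun do rewrite updE.
by case: (i == j); [exact: measurable_retract01|exact: measurable_cst].
Qed.

Lemma unit_cube_retract01 (R : realType) d (x : 'rV[R]_d) j u :
  unit_cube x -> unit_cube (upd x j (retract01 u)).
Proof.
move=> xc; apply: unit_cube_upd => //.
by have /andP[? ?] := retract01_bounds u; rewrite !ltW.
Qed.

Lemma bounded_measurable_hinge (R : realType) dT (T : measurableType dT)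
    (v : R) (h : T -> R) :
  bounded_measurable h -> bounded_measurable (fun t => Num.max (v - h t) 0).
Proof.
move=> bh.
have [mh [M hM]] := bounded_measurableD (bounded_measurable_cst v)
  (bounded_measurableN bh).
split; first exact: measurable_maxr.
exists M => t; have hMt := hM t; have M0 := le_trans (normr_ge0 _) hMt.
by rewrite /Num.max; case: ifP => // _; rewrite normr0.
Qed.

Lemma bounded_measurable_retract01 (R : realType) :
  bounded_measurable (retract01 : measurableTypeR R -> R).
Proof.
split; first exact: measurable_retract01.
exists 1 => u; have /andP[? ?] := retract01_bounds u.
by rewrite ger0_norm ltW.
Qed.

Lemma taylor_line (R : realType) d (j : 'I_d) (g : 'rV[R]_d -> R)
    (g1 g2 : 'rV[R]_d -> R) (x : 'rV[R]_d) (v : R) :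
  g1 = partial_deriv j g -> g2 = partial_deriv j g1 ->
  {within @unit_cube R d, continuous g} ->
  {within @unit_cube R d, continuous g1} ->
  {within @unit_cube R d, continuous g2} ->
  partial_derivable j g -> partial_derivable j g1 ->
  unit_cube x -> 0 <= v <= 1 ->
  g (upd x j v) = g (upd x j 0) + v * g1 (upd x j 0)
    + \int[unif01]_u (Num.max (v - retract01 u) 0 * g2 (upd x j (retract01 u))).
Proof.
move=> g1E g2E cg cg1 cg2 dg dg1 xc v01.
have D1 (u : R) : 0 < u < 1 ->
    is_derive u 1 (fun w => g (upd x j w)) (g1 (upd x j u)).
  by rewrite g1E; exact: line_is_derive.
have D2 (u : R) : 0 < u < 1 ->
    is_derive u 1 (fun w => g1 (upd x j w)) (g2 (upd x j u)).
  by rewrite g2E; exact: line_is_derive.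
have := @taylor_interval R (fun u => g (upd x j u)) (fun u => g1 (upd x j u))
  (fun u => g2 (upd x j u)) v (line_continuous cg xc) (line_continuous cg1 xc)
  (line_continuous cg2 xc) D1 D2 v01.
move=> ->; congr (_ + _).
have bm : bounded_measurable ((fun u => Num.max (v - retract01 u) 0 *
    g2 (upd x j (retract01 u))) : measurableTypeR R -> R).
  apply: bounded_measurableM.
    by apply: bounded_measurable_hinge; exact: bounded_measurable_retract01.
  apply: (@bounded_measurable_cube R d _ (measurableTypeR R) g2 (fun u => upd
    x j (retract01 u))) => //.
  - exact: measurable_retract01_upd.
  - by move=> u; exact: unit_cube_retract01.
rewrite Rintegral_unif01 //.
(* Both integrals are restricted to the open interval, which discards only the null set of
   endpoints; there the retraction is the identity. *)
have retract01E u : u \in (`]0, 1[%classic : set R) -> retract01 u = u.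
  by rewrite inE /= in_itv /= /retract01 => ->.
have [mg2 _] := bm.
rewrite /Rintegral; congr fine.
rewrite [LHS]integral_itv_bndoo; last first.
  apply/measurable_EFinP; apply: eq_measurable_fun (measurable_funTS mg2).
  by move=> u /retract01E ->.
rewrite [RHS]integral_itv_bndoo; last first.
  by apply/measurable_EFinP; exact: measurable_funTS.
by apply: eq_integral => u /retract01E ->.
Qed.

(** * The Taylor expansion in all coordinates *)

Section ProductIntegral.
Context {R : realType} {d1 d2 : measure_display}.
Context {T1 : measurableType d1} {T2 : measurableType d2}.
Variables (m1 : probability T1 R) (m2 : probability T2 R).

Lemma bounded_measurable_section (h : T1 * T2 -> R) t :
  bounded_measurable h -> bounded_measurable (fun u => h (t, u)).
Proof. by move=> bh; apply: (bounded_measurable_comp _ bh); exact: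
  measurable_pair1. Qed.

Definition prod_probability : probability (T1 * T2)%type R :=
  [the probability _ _ of (m1 \x m2)%E].

Lemma bounded_measurable_prod_integrable (h : T1 * T2 -> R) :
  bounded_measurable h -> (m1 \x m2)%E.-integrable setT (EFin \o h).
Proof. exact: (@bounded_measurable_integrable _ _ _ prod_probability). Qed.

Lemma EFin_Rintegral_bounded dT (T : measurableType dT) (mu : probability T R)
    (h : T -> R) : bounded_measurable h ->
  (\int[mu]_t h t)%:E = (\int[mu]_t (h t)%:E)%E.
Proof.
move=> bh; rewrite fineK //; apply: integrable_fin_num => //.
exact: bounded_measurable_integrable.
Qed.

(** Measurability of the partial integral comes from Fubini's theorem. The bound of [h] is kept
    because [m2] has mass one. *)
Lemma bounded_measurable_Rintegral (h : T1 * T2 -> R) :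
  bounded_measurable h -> bounded_measurable (fun t => \int[m2]_u h (t, u)).
Proof.
move=> bh; have [mh [M hM]] := bh; split.
  apply/measurable_EFinP.
  have -> : EFin \o (fun t => \int[m2]_u h (t, u)) =
      fubini_F m2 (EFin \o h).
    apply/funext => t; rewrite /= EFin_Rintegral_bounded //.
    exact: bounded_measurable_section.
  apply: (@measurable_fubini_F _ _ _ _ _ m1).
  exact: bounded_measurable_prod_integrable.
exists M => t; have bt := bounded_measurable_section t bh.
rewrite (le_trans (le_normr_Rintegral _ _)) //.
  exact: bounded_measurable_integrable.
rewrite -[leRHS](@Rintegral_probability_cst _ _ _ m2).
apply: le_Rintegral => //.
- apply: bounded_measurable_integrable => //.
  by case: bt => mt [N hN]; split; [exact: measurableT_comp|exists N => u;
    rewrite normr_id].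
- by apply: bounded_measurable_integrable => //; exact: bounded_measurable_cst.
Qed.

Lemma Rintegral_prod (h : T1 * T2 -> R) : bounded_measurable h ->
  \int[prod_probability]_w h w = \int[m1]_t \int[m2]_u h (t, u).
Proof.
move=> bh; rewrite [LHS]/Rintegral [RHS]/Rintegral; congr fine.
rewrite -integral12_prod_meas1; last exact: bounded_measurable_prod_integrable.
apply: eq_integral => t _; rewrite EFin_Rintegral_bounded //.
exact: bounded_measurable_section.
Qed.

End ProductIntegral.

Section Expansion.
Context {R : realType} {d : nat}.
Implicit Types (p : {ffun 'I_d -> 'I_3}) (x : 'rV[R]_d) (K : seq 'I_d).

Definition node T (tau : 'I_d -> T -> R) p (t : T) (i : 'I_d) : R :=
  if (p i : nat) == 2 then tau i t else 0.

Definition node_point T (tau : 'I_d -> T -> R) K x p (t : T) : 'rV[R]_d :=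
  \row_i (if i \in K then node tau p t i else x ord0 i).

(** An entry 1 gives the factor max(x_i - 0, 0), which is x_i on the cube, so a single formula
    serves the entries 1 and 2. *)
Definition node_hinge T (tau : 'I_d -> T -> R) K x p (t : T) : R :=
  \prod_(i <- K | (p i : nat) != 0) Num.max (x ord0 i - node tau p t i) 0.

(* Term of order p once the coordinates in K, and only those, are expanded. *)
Definition expansion_term T (tau : 'I_d -> T -> R) (f : 'rV[R]_d -> R) K x p
    (t : T) : R :=
  node_hinge tau K x p t * mixed_deriv p f (node_point tau K x p t).

Definition supported K p := [forall i, ((p i : nat) != 0) ==> (i \in K)].

(** Strict positivity keeps the point sampled for an order with an entry 2 away from the origin; the
    strict upper bound keeps it in the half-open cube. *)
Definition nodes dT (T : measurableType dT) (tau : 'I_d -> T -> R) : Prop :=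
  forall i, measurable_fun [set: T] (tau i) /\ forall t, 0 < tau i t < 1.

Lemma node_bounds dT (T : measurableType dT) (tau : 'I_d -> T -> R) p t i :
  nodes tau -> 0 <= node tau p t i < 1.
Proof.
move=> ntau; have [_ /(_ t) /andP[t0 t1]] := ntau i; rewrite /node.
by case: ifP => _; [rewrite (ltW t0) t1|rewrite lexx ltr01].
Qed.

Lemma bounded_measurable_node dT (T : measurableType dT) (tau : 'I_d -> T -> R)
    p i : nodes tau -> bounded_measurable (fun t => node tau p t i).
Proof.
move=> ntau; split.
  rewrite /node; case: ((p i : nat) == 2); last exact: measurable_cst.
  by have [] := ntau i.
exists 1 => t; have /andP[n0 n1] := node_bounds p t i ntau.
by rewrite ger0_norm // ltW.
Qed.

Lemma node_point_cube dT (T : measurableType dT) (tau : 'I_d -> T -> R)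
    K x p t : nodes tau -> unit_cube x -> unit_cube (node_point tau K x p t).
Proof.
move=> ntau xc i; rewrite mxE; case: ifP => // _.
by have /andP[-> /ltW ->] := node_bounds p t i ntau.
Qed.

Lemma bounded_measurable_node_hinge dT (T : measurableType dT)
    (tau : 'I_d -> T -> R) K x p :
  nodes tau -> bounded_measurable (node_hinge tau K x p).
Proof.
move=> ntau; apply: bounded_measurable_prod => i.
by apply: bounded_measurable_hinge; exact: bounded_measurable_node.
Qed.

Lemma bounded_measurable_node_deriv dT (T : measurableType dT)
    (tau : 'I_d -> T -> R) (g : 'rV[R]_d -> R) K x p :
  nodes tau -> unit_cube x -> {within @unit_cube R d, continuous g} ->
  bounded_measurable (fun t => g (node_point tau K x p t)).
Proof.
move=> ntau xc cf; apply: bounded_measurable_cube => //.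
  move=> i; under eq_fun do rewrite mxE.
  case: (i \in K); last exact: measurable_cst.
  by have [] := bounded_measurable_node p i ntau.
by move=> t; exact: node_point_cube.
Qed.

Definition set_order p (j : 'I_d) (a : 'I_3) : {ffun 'I_d -> 'I_3} :=
  [ffun i => if i == j then a else p i].

(** Since [p] vanishes at [j] and on [pre], the new derivatives in direction [j] come at the head of
    the list, that is, they are taken last. This is why coordinates are expanded from the last to
    the first. *)
Lemma directions_set_order pre K j p (a : 'I_3) :
  enum 'I_d = pre ++ j :: K -> supported K p ->
  directions (set_order p j a) = nseq a j ++ directions p.
Proof.
move=> eK /forallP sp; rewrite /directions eK !map_cat !flatten_cat /=.
have := enum_uniq 'I_d; rewrite eK cat_uniq /= => /and3P[_ hn /andP[jK _]].
have out i : i \notin K -> (p i : nat) = 0%N.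
  by move=> iK; apply/eqP; apply: contraNT iK => /(implyP (sp i)).
have pre0 (q : 'I_d -> 'I_3) : (forall i, i \in pre -> (q i : nat) = 0%N) ->
    flatten [seq nseq (q i) i | i <- pre] = [::].
  elim: (pre) => //= i s IH H; rewrite H ?mem_head //= IH // => k ks.
  by apply: H; rewrite inE ks orbT.
have prej i : i \in pre -> (i != j) && (i \notin K).
  move=> ip; move: hn; rewrite negb_or => /andP[jp /hasPn hK].
  apply/andP; split; first by apply: contraNneq jp => <-.
  by apply: contraL ip => /hK.
rewrite (pre0 (set_order p j a)); last first.
  by move=> i /prej /andP[ij iK]; rewrite ffunE (negbTE ij); exact: out.
rewrite (pre0 p); last by move=> i /prej /andP[_]; exact: out.
rewrite ffunE eqxx out //=; congr (_ ++ flatten _).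
apply/eq_in_map => i iK; rewrite ffunE; case: eqP => // ij.
by rewrite -ij iK in jK.
Qed.

Lemma set_order_supported K j p a :
  supported K p -> supported (j :: K) (set_order p j a).
Proof.
move=> /forallP sp; apply/forallP => i; apply/implyP; rewrite ffunE inE.
by case: (i =P j) => //= _ pi; exact: (implyP (sp i)).
Qed.

(** Orders supported on [j :: K] are grouped by what remains after resetting their entry at [j] to
    0; the erased entry parametrizes each group. *)
Lemma sum_supported_cons K j (F : {ffun 'I_d -> 'I_3} -> R) : j \notin K ->
  \sum_(p | supported (j :: K) p) F p =
  \sum_(p | supported K p) \sum_(a < 3) F (set_order p j a).
Proof.
move=> jK; rewrite (partition_big (fun p => set_order p j ord0) (supported K)).
  apply: eq_bigr => p sp.
  have p0 : p j = ord0.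
    apply/val_inj/eqP; apply: contraNT jK => pj.
    by move/forallP : sp => /(_ j) /implyP; apply.
  rewrite (reindex_onto (set_order p j) (fun q => q j)) /=; last first.
    move=> q /andP[_ /eqP qp]; apply/ffunP => i; rewrite ffunE -qp ffunE.
    by case: eqP => [->|].
  apply: eq_bigl => a; rewrite set_order_supported // ffunE eqxx eqxx andbT.
  apply/eqP/ffunP => i; rewrite !ffunE; case: eqP => // ->.
  by rewrite p0.
move=> q /forallP sq; apply/forallP => i; apply/implyP; rewrite ffunE.
case: (i =P j) => // ij qi; have /implyP/(_ qi) := sq i.
by rewrite inE => /predU1P[].
Qed.

End Expansion.

Section ExpansionStep.
Context {R : realType} {d : nat}.
Implicit Types (p : {ffun 'I_d -> 'I_3}) (x : 'rV[R]_d) (K : seq 'I_d).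
Variable f : 'rV[R]_d -> R.
Hypothesis hf : forall p : {ffun 'I_d -> 'I_3},
  mixed_derivable p f /\ {within @unit_cube R d, continuous (mixed_deriv p f)}.

(** The sample space gains one independent factor, which supplies coordinate [j]; the other
    coordinates still read the old factor. *)
Definition add_node T (tau : 'I_d -> T -> R) (j i : 'I_d)
    (w : T * measurableTypeR R) : R :=
  if i == j then retract01 w.2 else tau i w.1.

Lemma nodes_add_node dT (T : measurableType dT) (tau : 'I_d -> T -> R) j :
  nodes tau -> nodes (add_node tau j).
Proof.
move=> ntau i; rewrite /add_node; case: (i == j).
  by split; [exact: measurableT_comp measurable_retract01 _|move=> w; exact:
    retract01_bounds].
by have [mi bi] := ntau i; split => //; exact: measurableT_comp mi _.
Qed.

Lemma bounded_measurable_expansion_term dT (T : measurableType dT)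
    (tau : 'I_d -> T -> R) K x p : nodes tau -> unit_cube x ->
  bounded_measurable (expansion_term tau f K x p).
Proof.
move=> ntau xc; apply: bounded_measurableM.
  exact: bounded_measurable_node_hinge.
by apply: bounded_measurable_node_deriv => //; exact: (hf p).2.
Qed.

(** Taylor's formula in direction [j] is applied to [mixed_deriv p f] at the current node. Its three
    terms are the entries 0, 1, 2 of the new order at [j]; the first two are constant in the new
    sample. *)
Lemma expansion_step dT (T : measurableType dT) (tau : 'I_d -> T -> R)
    pre j K x p t : nodes tau -> enum 'I_d = pre ++ j :: K -> supported K p ->
    unit_cube x ->
  expansion_term tau f K x p t =
  \sum_(a < 3) \int[unif01]_u
    expansion_term (add_node tau j) f (j :: K) x (set_order p j a) (t, u).
Proof.
move=> ntau eK sp xc.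
have jK : j \notin K.
  by have := enum_uniq 'I_d; rewrite eK cat_uniq /= => /and3P[_ _ /andP[]].
pose g a := iter_deriv (nseq a j) (mixed_deriv p f).
have gE (a : 'I_3) : mixed_deriv (set_order p j a) f = g a.
  by rewrite /mixed_deriv (directions_set_order _ eK sp) /iter_deriv foldr_cat.
have cg (a : 'I_3) : {within @unit_cube R d, continuous (g a)}.
  by rewrite -gE; exact: (hf _).2.
have cgn n : (n < 3)%N -> {within @unit_cube R d, continuous (g n)}.
  by move=> n3; exact: (cg (Ordinal n3)).
(* Derivability for the order with entry 2 at [j] contains both successive derivabilities. *)
have [dg1 dg0] : partial_derivable j (g 1%N) /\ partial_derivable j (g 0%N).
  have [+ _] := hf (set_order p j (inord 2)).
  rewrite /mixed_derivable (directions_set_order _ eK sp) inordK //=.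
  by move=> [[_ ?] ?].
pose Y := node_point tau K x p t; pose k := node_hinge tau K x p t.
have Yc : unit_cube Y by exact: node_point_cube.
have Yj : Y ord0 j = x ord0 j by rewrite mxE (negbTE jK).
(* The hinge factor [k] of the coordinates in [K] does not see the new sample and factors out. *)
have termE (a : 'I_3) u : expansion_term (add_node tau j) f (j :: K) x
    (set_order p j a) (t, u) =
    k * ((if a == 0 :> nat then 1 else
          Num.max (x ord0 j - (if a == 2 :> nat then retract01 u else 0)) 0) *
      g a (upd Y j (if a == 2 :> nat then retract01 u else 0))).
  rewrite /expansion_term gE mulrA; congr (_ * g a _).
    rewrite /node_hinge big_cons ffunE eqxx /node ffunE eqxx /add_node eqxx.
    have -> : \prod_(i <- K | (set_order p j a i : nat) != 0)
        Num.max (x ord0 i - (if (set_order p j a i : nat) == 2 then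
          (if i == j then retract01 u else tau i t) else 0)) 0 = k.
      rewrite /k /node_hinge big_seq_cond [RHS]big_seq_cond.
      have ij i : i \in K -> (i == j) = false by move=> iK; apply:
        contraNF jK => /eqP <-.
      apply: eq_big => i.
        by case: (boolP (i \in K)) => //= iK; rewrite ffunE ij.
      by move=> /andP[iK _]; rewrite ffunE /node ij.
    by case: ifPn => [/negbTE -> |]; [rewrite mulrC|rewrite negbK => ->;
      rewrite mulr1].
  apply/rowP => i; rewrite updE !mxE inE /node ffunE /add_node.
  by case: eqP => //= _.
have [x0 x1] : 0 <= x ord0 j /\ x ord0 j <= 1 by have /andP[] := xc j.
rewrite /expansion_term -/Y -/k -[mixed_deriv p f]/(g 0%N).
rewrite -(upd_id Y j) Yj.
have := @taylor_line R d j (g 0%N) (g 1%N) (g 2%N) Y (x ord0 j) erefl erefl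
  (cgn 0%N isT) (cgn 1%N isT) (cgn 2%N isT) dg0 dg1 Yc (xc j).
move=> ->.
rewrite (eq_bigr _ (fun a _ => eq_Rintegral _ (fun u _ => termE a u))).
have sum3 (F : 'I_3 -> R) : \sum_(a < 3) F a =
    F ord0 + (F (lift ord0 ord0) + F (lift ord0 (lift ord0 ord0))).
  by rewrite 3!big_ord_recl big_ord0 addr0.
rewrite sum3 mulrDr mulrDr -addrA.
congr (_ + (_ + _)).
- rewrite -[LHS](@Rintegral_probability_cst _ _ _ unif01).
  by apply: eq_Rintegral => u _; rewrite /= mul1r.
- rewrite -[LHS](@Rintegral_probability_cst _ _ _ unif01).
  by apply: eq_Rintegral => u _; rewrite /= subr0 max_l.
- rewrite -RintegralZl //.
  apply: bounded_measurable_integrable => //; apply: bounded_measurableM.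
    by apply: bounded_measurable_hinge; exact: bounded_measurable_retract01.
  apply: (@bounded_measurable_cube R d _ (measurableTypeR R) (g 2%N)
    (fun u => upd Y j (retract01 u))).
  - exact: cgn.
  - exact: measurable_retract01_upd.
  - by move=> u; exact: unit_cube_retract01.
Qed.

(** Induction on the suffix [K] of coordinates already expanded. The sample space is chosen before
    [x] and shared by all orders, so the measures built from it do not depend on [x]. *)
Lemma expansion_suffix pre K : enum 'I_d = pre ++ K ->
  exists dT (T : measurableType dT) (mu : probability T R)
    (tau : 'I_d -> T -> R), nodes tau /\
  forall x, unit_cube x ->
    f x = \sum_(p | supported K p) \int[mu]_t expansion_term tau f K x p t.
Proof.
elim: K pre => [|j K IH] pre eK.
  (* With nothing expanded, a one-point space suffices and only the zero order is supported; 1/2 is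
     an arbitrary value in (0,1). *)
  exists _, unit, [the probability _ _ of \d_tt], (fun _ _ => 1 / 2); split.
    by move=> i; split => [|_]; [exact: measurable_cst|lra].
  move=> x xc; rewrite (big_pred1 [ffun=> ord0]) => [|p].
    transitivity (\int[\d_tt]_(t in [set: unit]) f x); first by
      rewrite Rintegral_probability_cst.
    apply: eq_Rintegral => t _.
    rewrite /expansion_term /node_hinge big_nil [RHS]mul1r /mixed_deriv.
    have -> : directions [ffun=> ord0] = [::] :> seq 'I_d.
      by rewrite /directions; elim: (enum _) => //= i s ->; rewrite ffunE.
    rewrite /iter_deriv /=; congr (f _).
    by apply/rowP => i; rewrite mxE.
  apply/forallP/eqP => [sp|-> i]; last by rewrite ffunE.
  apply/ffunP => i; rewrite ffunE; have := sp i;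
    rewrite implybF negbK => /eqP pi.
  exact/val_inj.
have [|dT [T [mu [tau [ntau fE]]]]] := IH (rcons pre j).
  by rewrite eK cat_rcons.
exists _, (T * measurableTypeR R)%type, (prod_probability mu unif01),
  (add_node tau j); split; first exact: nodes_add_node.
move=> x xc; rewrite (fE x xc).
have jK : j \notin K.
  by have := enum_uniq 'I_d; rewrite eK cat_uniq /= => /and3P[_ _ /andP[]].
rewrite sum_supported_cons //; apply: eq_bigr => p sp.
have bm a := bounded_measurable_expansion_term (j :: K) (set_order p j a)
  (nodes_add_node j ntau) xc.
under eq_Rintegral do rewrite (expansion_step _ ntau eK sp xc).
rewrite Rintegral_sum; last first.
  move=> a; exact: (bounded_measurable_Rintegral mu unif01 (bm a)).
by apply: eq_bigr => a _; rewrite Rintegral_prod.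
Qed.

End ExpansionStep.

(** * Differences to the coordinate faces *)

Section FaceDifference.
Context {R : realType} {d : nat}.
Implicit Types (x y : 'rV[R]_d) (i j : 'I_d) (f g h : 'rV[R]_d -> R).

Definition face_diff h j : 'rV[R]_d -> R := fun x => h x - h (upd x j 0).

Lemma unit_cube_face x j : unit_cube x -> unit_cube (upd x j 0).
Proof. by move=> xc; apply: unit_cube_upd => //; rewrite lexx ler01. Qed.

Lemma partial_derivable_continuous j g x : partial_derivable j g ->
  unit_cube x -> g (upd x j (x ord0 j + h)) @[h --> increments j x] --> g x.
Proof.
move=> dg xc; have FF := increments_proper j xc.
have h0 : h @[h --> increments j x] --> (0 : R).
  by move=> P [e /= e0 He]; exists e => //= t te _ _; exact: He.
have := cvgD (cvg_cst (g x)) (cvgM h0 (partial_derivP dg xc)).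
have FF' : Filter (increments j x) by exact: filter_filter.
rewrite mul0r addr0 => /(_ FF' FF' FF') H.
apply: (cvg_trans _ H); apply: near_eq_cvg.
rewrite /increments !near_withinE /=.
near=> h => h_n0 _ /=.
change (g x + h * diff_quotient j g x h = g (upd x j (x ord0 j + h))).
by rewrite diff_quotientE mulrC divfK // addrC subrK.
Unshelve. all: by end_near. Qed.

(** The filter is left general to cover both one-sided limits, from the right at 0 and from the left
    at the other end of a segment. *)
Lemma within_line_cvg j g x (u : R) (F : set_system R) :
  partial_derivable j g ->
  unit_cube x -> 0 <= u <= 1 -> F --> within [set v : R | 0 <= v <= 1] u^' ->
  g (upd x j v) @[v --> F] --> g (upd x j u).
Proof.
move=> dg xc u01 Fu.
have := partial_derivable_continuous dg (unit_cube_upd j xc u01).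
rewrite updE eqxx => H.
have -> : (fun v : R => g (upd x j v)) =
    (fun t : R => g (upd (upd x j u) j (u + t))) \o (fun v : R => v - u).
  by apply/funext => v /=; rewrite upd_upd addrC subrK.
suff K : (v - u) @[v --> F] --> increments j (upd x j u).
  by move=> Q nQ; exact: (K _ (H Q nQ)).
move=> P iP; apply: Fu; move: iP.
rewrite incrementsE; last exact: unit_cube_upd.
rewrite updE eqxx => -[e /= e0 He]; exists e => //= v /= vu v_nu v01.
have := He (v - u); rewrite /ball_ /= sub0r normrN distrC; apply => //.
  by rewrite subr_eq0.
by rewrite addrC subrK.
Qed.

(** Mean value theorem on the segment from 0 to x_j. Continuity up to the endpoints is drawn from
    derivability alone, so the lemma applies to iterated derivatives of differences. *)
Lemma face_diff_eq0 j g : partial_derivable j g ->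
  (forall x, unit_cube x -> partial_deriv j g x = 0) ->
  forall x, unit_cube x -> face_diff g j x = 0.
Proof.
move=> dg g0 x xc; rewrite /face_diff; have /andP[b0 b1] := xc j.
set b := x ord0 j in b0 b1; rewrite -{1}(upd_id x j) -/b.
move: b0; rewrite le_eqVlt => /predU1P[<-|b0]; first by rewrite subrr.
have dline u : u \in `]0, b[%R ->
  is_derive u 1 (fun v => g (upd x j v)) (cst 0 u).
  rewrite in_itv /= => /andP[u0 ub]; have u01 : 0 < u < 1 by
    rewrite u0 (lt_le_trans ub b1).
  have := line_is_derive dg xc u01; rewrite g0 //.
  by apply: unit_cube_upd => //; have /andP[? ?] := u01; rewrite !ltW.
have cline : {within `[0, b], continuous (fun v => g (upd x j v))}.
  apply/(continuous_within_itvP _ b0); split.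
  - move=> u /dline [du _]; apply: differentiable_continuous;
    exact/derivable1_diffP.
  - apply: (within_line_cvg dg xc); first by rewrite lexx ler01.
    move=> P [e /= e0 He]; exists (Num.min e 1) => /=; first by
      rewrite lt_min e0 ltr01.
    move=> v /=; rewrite sub0r normrN lt_min => /andP[ve v1] v0.
    apply: He => //=; first by rewrite sub0r normrN.
      by rewrite gt_eqF.
    by rewrite ltW //= ltW // (le_lt_trans (ler_norm v)).
  - apply: (within_line_cvg dg xc); first by rewrite ltW.
    move=> P [e /= e0 He]; exists (Num.min e b) => /=; first by
      rewrite lt_min e0.
    move=> v /=; rewrite lt_min => /andP[ve vb] v0.
    apply: He => //=; first by rewrite lt_eqF.
    apply/andP; split; last by rewrite (le_trans (ltW v0)).
    by move: vb; rewrite gtr0_norm ?subr_gt0 //; lra.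
by have [c _ ->] := MVT b0 dline cline; rewrite mul0r.
Qed.

Lemma face_diff_deriv i j h : i != j -> partial_derivable i h ->
  partial_derivable i (face_diff h j) /\ forall x, unit_cube x ->
    partial_deriv i (face_diff h j) x = face_diff (partial_deriv i h) j x.
Proof.
move=> ij dh.
have cv x : unit_cube x -> diff_quotient i (face_diff h j) x t @[t -->
  increments i x]
    --> face_diff (partial_deriv i h) j x.
  move=> xc; have FF := increments_proper i xc.
  have x0c := unit_cube_face j xc.
  have -> : diff_quotient i (face_diff h j) x = (fun t =>
      diff_quotient i h x t - diff_quotient i h (upd x j 0) t).
    apply/funext => t; rewrite !diff_quotientE /face_diff updE (negbTE ij).
    by rewrite (updC _ _ _ ij); ring.
  apply: cvgB; first exact: partial_derivP.
  have := partial_derivP dh x0c.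
  by rewrite !incrementsE // updE (negbTE ij).
split=> x xc; last by have FF := increments_proper i xc; exact/cvg_lim/cv.
by apply/cvg_ex; exists (face_diff (partial_deriv i h) j x); exact: cv.
Qed.

(** Derivatives of differences are known only on the cube; this lets such identities pass under a
    further derivative. *)
Lemma partial_deriv_ext i g h : (forall x, unit_cube x -> g x = h x) ->
  partial_derivable i g -> partial_derivable i h /\
  forall x, unit_cube x -> partial_deriv i h x = partial_deriv i g x.
Proof.
move=> gh dg.
have cv x : unit_cube x -> diff_quotient i h x t @[t --> increments i x]
    --> partial_deriv i g x.
  move=> xc; apply: (cvg_trans _ (partial_derivP dg xc)).
  apply: near_eq_cvg; rewrite /increments near_withinE; near=> t => xt.
  by rewrite /diff_quotient !gh.
split=> x xc; last by have FF := increments_proper i xc; exact/cvg_lim/cv.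
by apply/cvg_ex; exists (partial_deriv i g x); exact: cv.
Unshelve. all: by end_near. Qed.

Lemma iter_deriv_face_diff js j h : j \notin js -> iter_derivable js h ->
  iter_derivable js (face_diff h j) /\ forall x, unit_cube x ->
    iter_deriv js (face_diff h j) x = face_diff (iter_deriv js h) j x.
Proof.
elim: js => [//|i js IH]; rewrite inE negb_or => /andP[ji jjs] /= [dh dih].
have [d1 e1] := IH jjs dh.
rewrite eq_sym in ji; have [d2 e2] := face_diff_deriv ji dih.
have [d3 e3] := partial_deriv_ext (fun x xc => esym (e1 x xc)) d2.
by split=> [|x xc]; [split|rewrite /= e3 // e2].
Qed.

(** The outermost derivative vanishes, so the difference in its direction does too. That difference
    moves inside the remaining derivatives, whose directions are distinct from it, and the induction
    continues with [face_diff h j]. *)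
Lemma foldl_face_diff_eq0 js h : uniq js -> iter_derivable js h ->
  (forall x, unit_cube x -> iter_deriv js h x = 0) ->
  forall x, unit_cube x -> foldl face_diff h js x = 0.
Proof.
elim: js h => [//|j js IH] h /= /andP[jjs ujs] [dh djh] h0.
have [d1 e1] := iter_deriv_face_diff jjs dh.
by apply: IH => // x xc; rewrite e1 //; exact: face_diff_eq0.
Qed.

(** A difference in direction [j] leaves [V S] unchanged if [j] is in [S], since [V S] vanishes on
    that face, and kills it otherwise, by locality. *)
Lemma foldl_face_diff_sum (V : {set 'I_d} -> 'rV[R]_d -> R) (P :
  pred {set 'I_d})
    js h :
  (forall (S : {set 'I_d}) x y, (forall i, i \in S -> x ord0 i = y ord0 i) ->
    V S x = V S y) ->
  (forall (S : {set 'I_d}) x j, unit_cube x -> j \in S -> x ord0 j = 0 ->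
    V S x = 0) ->
  (forall x, unit_cube x -> h x = \sum_(S | P S) V S x) ->
  forall x, unit_cube x -> foldl face_diff h js x =
    \sum_(S | P S && all (fun j => j \in S) js) V S x.
Proof.
move=> Vloc V0; elim: js h P => [|j js IH] h P hV x xc /=.
  by rewrite hV //; apply: eq_bigl => S; rewrite andbT.
rewrite (IH _ (fun S => P S && (j \in S))) //.
  by apply: eq_bigl => S; rewrite andbA.
move=> y yc; have y0c := unit_cube_face j yc.
rewrite /face_diff !hV // -sumrB [RHS]big_mkcondr; apply: eq_bigr => S _.
case: ifP => jS.
  by rewrite (V0 S (upd y j 0) j) ?subr0 // updE eqxx.
rewrite (Vloc S (upd y j 0) y) ?subrr // => i iS; rewrite updE.
by case: eqP => // ij; rewrite ij jS in iS.
Qed.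

Lemma anchored_component_eq0 (V : {set 'I_d} -> 'rV[R]_d -> R) f js
    (S : {set 'I_d}) :
  (forall (S : {set 'I_d}) x y, (forall i, i \in S -> x ord0 i = y ord0 i) ->
    V S x = V S y) ->
  (forall (S : {set 'I_d}) x j, unit_cube x -> j \in S -> x ord0 j = 0 ->
    V S x = 0) ->
  (forall x, unit_cube x -> f x = \sum_S V S x) ->
  uniq js -> js =i S -> iter_derivable js f ->
  (forall x, unit_cube x -> iter_deriv js f x = 0) ->
  forall x, unit_cube x -> V S x = 0.
Proof.
move=> Vloc V0 fV ujs jsS df f0 x xc.
(* The differences keep the components of all supersets of [S]. At [y] the strict supersets vanish,
   while [V S] has the same value as at [x]. *)
pose y : 'rV[R]_d := \row_i (if i \in S then x ord0 i else 0).
have yc : unit_cube y by move=> i; rewrite mxE; case: ifP;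
  rewrite // lexx ler01.
rewrite (Vloc S x y); last by move=> i iS; rewrite mxE iS.
have := foldl_face_diff_sum js Vloc V0 fV yc.
rewrite (foldl_face_diff_eq0 ujs df f0 yc) (bigD1 S) /=; last first.
  by apply/allP => j; rewrite jsS.
rewrite big1 ?addr0 // => S' /andP[/allP sub nS].
have [j jS' jS] : exists2 j, j \in S' & j \notin S.
  apply/subsetPn; apply: contra nS => S'S; rewrite finset.eqEsubset S'S.
  rewrite andTb; apply/fintype.subsetP => j; rewrite -jsS; exact: sub.
by apply: (V0 _ _ j) => //; rewrite mxE (negbTE jS).
Qed.

End FaceDifference.

(** * Finite measures with a density, and their push-forwards *)

Section MeasureAdd.
Context {R : realType} {dT : measure_display} {T : measurableType dT}.
Variables m1 m2 : {finite_measure set T -> \bar R}.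

Let fin_num_measure_add : fin_num_fun (measure_add m1 m2).
Proof.
by move=> A mA; rewrite measure_addE fin_numD !fin_num_measure.
Qed.

HB.instance Definition _ := Measure.on (measure_add m1 m2).

HB.instance Definition _ :=
  Measure_isFinite.Build _ _ _ (measure_add m1 m2) fin_num_measure_add.

Definition finite_measure_add : {finite_measure set T -> \bar R} :=
  measure_add m1 m2.

End MeasureAdd.

Section Density.
Context {R : realType} {dT : measure_display} {T : measurableType dT}.
Variables (mu : probability T R) (w : T -> R).
Hypothesis bw : bounded_measurable w.
Hypothesis w_ge0 : forall t, 0 <= w t.

(* The unused arguments let the measure instances, which need both hypotheses,
   be attached to this constant. *)
Definition with_density (bw : bounded_measurable w) (w_ge0 : forall t, 0 <= w t)
   (A : set T) : \bar R := (\int[mu]_(t in A) (w t)%:E)%E.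

Local Notation dens := (with_density bw w_ge0).

Let density0 : dens set0 = 0%E.
Proof. by rewrite /with_density integral_set0. Qed.

Let density_ge0 A : (0 <= dens A)%E.
Proof. by apply: integral_ge0 => t _; rewrite lee_fin. Qed.

Let density_sigma_additive : semi_sigma_additive dens.
Proof.
move=> /= F mF tF mUF; rewrite /with_density; apply: cvg_toP.
  apply: ereal_nondecreasing_is_cvgn => m n mn.
  by apply: lee_sum_nneg_natr => // k _ _; exact: density_ge0.
rewrite ge0_integral_bigcup //=.
- by apply/measurable_EFinP/measurable_funTS; have [] := bw.
- by move=> t _; rewrite lee_fin.
Qed.

HB.instance Definition _ := isMeasure.Build _ _ _ dens
  density0 density_ge0 density_sigma_additive.

Let fin_num_density : fin_num_fun dens.
Proof.
move=> A mA; apply: integrable_fin_num => //.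
exact: bounded_measurable_integrable.
Qed.

HB.instance Definition _ :=
  Measure_isFinite.Build _ _ _ dens fin_num_density.

Definition density_measure : {finite_measure set T -> \bar R} := dens.

Lemma density_dominates : density_measure `<< mu.
Proof.
apply/null_content_dominatesP => A mA muA; apply: null_set_integral => //.
by apply/measurable_EFinP/measurable_funTS; have [] := bw.
Qed.

(** The Radon-Nikodym derivative of the measure has the same integral as [w] over every measurable
    set, hence equals [w] almost everywhere; the change of variables formula then concludes. *)
Lemma integral_density (h : T -> R) :
  measurable_fun [set: T] h -> (forall t, 0 <= h t) ->
  (\int[density_measure]_t (h t)%:E = \int[mu]_t (h t * w t)%:E)%E.
Proof.
move=> mh h0; have numu := density_dominates.
pose rn := Radon_Nikodym_SigmaFinite.f density_measure mu.
rewrite -(Radon_Nikodym_SigmaFinite.change_of_variables numu (f := EFin \o h))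
  //; last first.
  exact/measurable_EFinP.
have mrn : measurable_fun [set: T] rn.
  exact: measurable_int (Radon_Nikodym_SigmaFinite.f_integrable numu).
have mw : measurable_fun [set: T] (EFin \o w).
  by apply/measurable_EFinP; have [] := bw.
have aew : ae_eq mu setT rn (EFin \o w).
  apply: integral_ae_eq => // [|A _ mA].
    exact: Radon_Nikodym_SigmaFinite.f_integrable.
  by rewrite -(Radon_Nikodym_SigmaFinite.f_integral numu).
under [RHS]eq_integral do rewrite EFinM.
apply: ae_eq_integral => //.
- by apply: emeasurable_funM => //; exact/measurable_EFinP.
- by apply: emeasurable_funM => //; exact/measurable_EFinP.
- exact: ae_eqe_mul2l.
Qed.

End Density.

Section FinitePushforward.
Context {R : realType} {d1 d2 : measure_display}.
Context {T1 : measurableType d1} {T2 : measurableType d2}.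
Variables (phi : T1 -> T2) (mphi : measurable_fun [set: T1] phi).
Variable m : {finite_measure set T1 -> \bar R}.

(* As for with_density, mphi is an argument only for the instances below. *)
Definition finite_push (mphi : measurable_fun [set: T1] phi) : set T2 ->
  \bar R :=
  pushforward m phi.

Let pm : {measure set T2 -> \bar R} :=
  measure_function_pushforward__canonical__measure_function_Measure m mphi.

HB.instance Definition _ := isMeasure.Build _ _ _ (finite_push mphi)
  (measure0 pm) (measure_ge0 pm) (@measure_semi_sigma_additive _ _ _ pm).

Let fin_num_push : fin_num_fun (finite_push mphi).
Proof.
move=> A mA; apply: fin_num_measure.
by rewrite -[X in measurable X]setTI; exact: mphi.
Qed.

HB.instance Definition _ :=
  Measure_isFinite.Build _ _ _ (finite_push mphi) fin_num_push.

Definition finite_pushforward : {finite_measure set T2 -> \bar R} :=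
  finite_push mphi.

Lemma integral_finite_pushforward D (h : T2 -> \bar R) : measurable D ->
  measurable_fun D h -> (forall y, 0 <= h y)%E ->
  (\int[finite_pushforward]_(y in D) h y =
   \int[m]_(t in phi @^-1` D) h (phi t))%E.
Proof.
move=> mD mh h0; rewrite -(ge0_integral_pushforward mphi) //.
Qed.

End FinitePushforward.

Section PushforwardDensity.
Context {R : realType} {d1 d2 : measure_display}.
Context {T1 : measurableType d1} {T2 : measurableType d2}.
Variables (mu : probability T1 R) (D : set T2).
Hypothesis mD : measurable D.

(** The measure is the sum over [r] of the images under [phi i] of the laws with density [w i]. It
    vanishes off [D] because every [phi i] takes its values in [D]. *)
Lemma sum_pushforward_density (I : eqType) (r : seq I)
    (phi : I -> T1 -> T2) (w : I -> T1 -> R) :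
  (forall i, i \in r -> [/\ measurable_fun [set: T1] (phi i),
     bounded_measurable (w i), forall t, 0 <= w i t & forall t, D (phi i t)]) ->
  exists nu : {finite_measure set T2 -> \bar R}, nu (~` D) = 0%E /\
    forall h : T2 -> R, measurable_fun [set: T2] h -> (forall y, 0 <= h y) ->
      (\int[nu]_(y in D) (h y)%:E =
       \sum_(i <- r) \int[mu]_t (h (phi i t) * w i t)%:E)%E.
Proof.
elim: r => [_|i r IH H].
  exists [the {finite_measure set T2 -> \bar R} of mzero]; split => // h mh h0.
  by rewrite big_nil integral_measure_zero.
have [mphi bw w0 Dphi] := H i (mem_head _ _).
have [|nu [nuD nuE]] := IH.
  by move=> k kr; apply: H; rewrite inE kr orbT.
pose nu1 := finite_pushforward mphi (density_measure mu bw w0).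
exists (finite_measure_add nu1 nu); split.
  have -> : finite_measure_add nu1 nu (~` D) = (nu1 (~` D) + nu (~` D))%E.
    exact: measure_addE.
  rewrite nuD adde0.
  have phiD0 : phi i @^-1` (~` D) = set0.
    by apply/seteqP; split => t //= nD; exact: (nD (Dphi t)).
  transitivity (density_measure mu bw w0 set0); last exact: measure0.
  by rewrite -phiD0.
move=> h mh h0; rewrite ge0_integral_measure_add //; last 2 first.
- by move=> y _; rewrite lee_fin.
- by apply/measurable_EFinP; exact: measurable_funTS.
rewrite big_cons; congr (_ + _)%E; last exact: nuE.
rewrite integral_finite_pushforward //; last first.
  by apply/measurable_EFinP; exact: measurable_funTS.
have -> : phi i @^-1` D = setT by apply/seteqP; split => t //= _; exact: Dphi.
rewrite -(integral_density mu bw w0) //.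
exact: (measurableT_comp mh mphi).
Qed.

End PushforwardDensity.

(** * Measurability of the punctured cube and of the hinge products *)

Lemma measurable_punctured_cube (R : realType) n :
  measurable (@punctured_cube R n).
Proof.
have mt (i : 'I_n) : measurable_fun [set: n.-tuple (measurableTypeR R)]
    (fun t => tnth t i : R) by exact: measurable_tnth.
have -> : @punctured_cube R n =
    (\bigcap_(i in [set: 'I_n]) ((fun t => tnth t i : R) @^-1` `[0, 1[)) `&`
    (\bigcup_(i in [set: 'I_n]) ((fun t => tnth t i : R) @^-1` (~` [set 0]))).
  apply/seteqP; split => t /=.
    move=> [t01 [i ti]]; split; first by move=> j _ /=; rewrite in_itv /= t01.
    by exists i => //=; exact/eqP.
  move=> [t01 [i _ /eqP ti]]; split; last by exists i.
  by move=> j; have := t01 j I; rewrite /= in_itv.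
apply: measurableI.
  apply: fin_bigcap_measurable; first exact: finite_finset.
  by move=> i _; rewrite -[X in measurable X]setTI; exact: mt.
apply: fin_bigcup_measurable; first exact: finite_finset.
move=> i _; rewrite -[X in measurable X]setTI; apply: mt => //.
exact: measurableC.
Qed.

Lemma measurable_hinge_product (R : realType) d (S : {set 'I_d})
    (x : 'rV[R]_d) :
  measurable_fun [set: #|S|.-tuple (measurableTypeR R)] (@hinge_product R d S
    x).
Proof.
apply: measurable_prod => i _; apply: measurable_maxr; last exact:
  measurable_cst.
by apply: measurable_funB; [exact: measurable_cst|exact: measurable_tnth].
Qed.

(** * Grouping the orders by support *)

Section Components.
Context {R : realType} {d : nat}.
Implicit Types (p : {ffun 'I_d -> 'I_3}) (x : 'rV[R]_d) (S : {set 'I_d}).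

Definition order_supp p : {set 'I_d} := [set j | (p j : nat) != 0].

Definition indicator_order S : {ffun 'I_d -> 'I_3} :=
  [ffun j => if j \in S then inord 1 else ord0].

Lemma indicator_orderE S j : (indicator_order S j : nat) = (j \in S).
Proof. by rewrite ffunE; case: ifP => _ //; rewrite inordK. Qed.

Lemma order_supp_indicator S : order_supp (indicator_order S) = S.
Proof. by apply/setP => j; rewrite inE indicator_orderE; case: (j \in S). Qed.

(** An entry that differs from the indicator of its own nonvanishing can only be 2. So the sign
    hypothesis covers all orders of a given support but one. *)
Lemma order_twoP p : p != indicator_order (order_supp p) ->
  exists j, (p j : nat) = 2.
Proof.
move=> pN; have /existsP[j jp] :
  [exists j, p j != indicator_order (order_supp p) j].
  rewrite -negb_forall; apply: contra pN => /forallP H.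
  by apply/eqP/ffunP => j; exact/eqP.
exists j; move: jp; rewrite -val_eqE /= indicator_orderE inE.
by case: (p j) => -[|[|[|]]].
Qed.

Lemma bigmax_order_two p j : (p j : nat) = 2 -> (\max_(j < d) (p j :
  nat))%N = 2.
Proof.
move=> pj; apply/eqP; rewrite eqn_leq; apply/andP; split.
  by apply/bigmax_leqP => i _; rewrite -ltnS.
by rewrite -pj; exact: (leq_bigmax j).
Qed.

Lemma directions_indicator S :
  directions (indicator_order S) = [seq j <- enum 'I_d | j \in S].
Proof.
rewrite /directions; elim: (enum _) => //= j s ->.
by rewrite indicator_orderE; case: (j \in S).
Qed.

Definition row_node T (tau : 'I_d -> T -> R) p (t : T) : 'rV[R]_d :=
  \row_i node tau p t i.

(** Once every coordinate is expanded the node no longer depends on [x], so the derivative at it can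
    serve as a density. *)
Lemma node_point_enum T (tau : 'I_d -> T -> R) x p t :
  node_point tau (enum 'I_d) x p t = row_node tau p t.
Proof. by apply/rowP => i; rewrite !mxE mem_enum inE. Qed.

Lemma node_hinge_enum T (tau : 'I_d -> T -> R) x p t :
  node_hinge tau (enum 'I_d) x p t =
  \prod_(i in order_supp p) Num.max (x ord0 i - node tau p t i) 0.
Proof. by rewrite /node_hinge big_enum_cond; apply: eq_bigl => i;
  rewrite !inE. Qed.

Lemma hinge_product_node T (tau : 'I_d -> T -> R) x p S t :
  order_supp p = S ->
  hinge_product x [tuple node tau p t (enum_val i) | i < #|S|] =
  node_hinge tau (enum 'I_d) x p t.
Proof.
move=> pS; rewrite node_hinge_enum pS /hinge_product [RHS]big_enum_val /=.
by apply: eq_bigr => i _; rewrite tnth_mktuple.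
Qed.

End Components.

(** * Membership in the classes *)

Theorem proposition3 (R : realType) (d s : nat) (hd : (1 <= d)%N)
    (hs : (1 <= s <= d)%N) (f : 'rV[R]_d -> R)
    (hf : forall p : {ffun 'I_d -> 'I_3},
      mixed_derivable p f /\
      {within @unit_cube R d, continuous (mixed_deriv p f)})
    (hneg : forall p : {ffun 'I_d -> 'I_3},
      (\max_(j < d) (p j : nat))%N = 2%N ->
      forall x : 'rV[R]_d, unit_cube x -> mixed_deriv p f x <= 0) :
  F_TC d f /\
  ((forall p : {ffun 'I_d -> 'I_3},
      (forall j : 'I_d, (p j <= 1)%N) -> (s < \sum_(j < d) (p j : nat))%N ->
      forall x : 'rV[R]_d, unit_cube x -> mixed_deriv p f x = 0) ->
   F_TC s f).
Proof.
have [dT [T [mu [tau [ntau fE]]]]] := expansion_suffix hf (pre := [::]) erefl.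
pose term p x := \int[mu]_t expansion_term tau f (enum 'I_d) x p t.
have bterm p x : unit_cube x ->
    bounded_measurable (expansion_term tau f (enum 'I_d) x p).
  exact: bounded_measurable_expansion_term.
pose V (S : {set 'I_d}) x := \sum_(p | order_supp p == S) term p x.
have fV x : unit_cube x -> f x = \sum_S V S x.
  move=> xc; rewrite (fE x xc) (partition_big (@order_supp d) predT) //=.
  apply: eq_bigr => S _; apply: eq_bigl => p.
  by rewrite (_ : supported _ _) //; apply/forallP => i;
    rewrite mem_enum inE implybT.
have Vloc (S : {set 'I_d}) (x y : 'rV[R]_d) :
    (forall i, i \in S -> x ord0 i = y ord0 i) -> V S x = V S y.
  move=> xy; apply: eq_bigr => p /eqP pS; apply: eq_Rintegral => t _.
  rewrite /expansion_term !node_point_enum !node_hinge_enum; congr (_ * _).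
  by apply: eq_bigr => i; rewrite pS => /xy ->.
(* The hinge factor at [j] is max(-z_j, 0) with z_j nonnegative. *)
have V0 (S : {set 'I_d}) (x : 'rV[R]_d) j :
    unit_cube x -> j \in S -> x ord0 j = 0 -> V S x = 0.
  move=> _ jS xj; apply: big1 => p /eqP pS.
  rewrite -[RHS](Rintegral_probability_cst mu); apply: eq_Rintegral => t _.
  rewrite /expansion_term node_hinge_enum (bigD1 j) ?pS //= xj sub0r max_r
    ?mul0r //.
  by rewrite oppr_le0; have /andP[] := node_bounds p t j ntau.
pose beta (S : {set 'I_d}) := mixed_deriv (indicator_order S) f 0.
have term1 (S : {set 'I_d}) x : unit_cube x ->
    term (indicator_order S) x = beta S * \prod_(j in S) x ord0 j.
  move=> xc; rewrite -[RHS](Rintegral_probability_cst mu); apply: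
    eq_Rintegral => t _.
  have n0 i : node tau (indicator_order S) t i = 0.
    by rewrite /node indicator_orderE; case: (i \in S).
  rewrite /expansion_term node_point_enum node_hinge_enum mulrC.
  rewrite order_supp_indicator; congr (mixed_deriv _ _ _ * _).
    by apply/rowP => i; rewrite !mxE n0.
  by apply: eq_bigr => i _; rewrite n0 subr0 max_l //; have /andP[] := xc i.
have c0 : unit_cube (0 : 'rV[R]_d) by move=> i; rewrite mxE lexx ler01.
pose w p t := - mixed_deriv p f (row_node tau p t).
have cnode p t : unit_cube (row_node tau p t).
  by rewrite -(node_point_enum tau 0); exact: node_point_cube.
have bw p : bounded_measurable (w p).
  apply: bounded_measurableN; under eq_fun do rewrite -(node_point_enum tau 0).
  by apply: bounded_measurable_node_deriv => //; exact: (hf p).2.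
(* All orders of support [S] except the indicator of [S] have an entry 2, so their densities [w p]
   are nonnegative. *)
have ex_nu (S : {set 'I_d}) : exists nu : {finite_measure set
      (#|S|.-tuple (measurableTypeR R)) -> \bar R},
    nu (~` @punctured_cube R #|S|) = 0%E /\ forall x, unit_cube x ->
    \int[nu]_(t in @punctured_cube R #|S|) hinge_product x t =
    - \sum_(p | (order_supp p == S) && (p != indicator_order S)) term p x.
  have [|nu [nu0 nuE]] := sum_pushforward_density mu
      (@measurable_punctured_cube R #|S|)
      (r := [seq p <- enum {ffun 'I_d -> 'I_3} |
        (order_supp p == S) && (p != indicator_order S)])
      (phi := fun p t => [tuple node tau p t (enum_val i) | i < #|S|])
      (w := w).
    move=> p; rewrite mem_filter => /andP[/andP[/eqP pS pN] _].
    rewrite -pS in pN; have [j pj] := order_twoP pN.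
    split => //.
    - apply/measurable_fun_tnthP => i.
      apply: (@eq_measurable_fun _ _ _ _ _ (fun t => node tau p t (enum_val
        i))).
        by move=> t _; rewrite /= tnth_mktuple.
      by have [] := bounded_measurable_node p (enum_val i) ntau.
    - move=> t; rewrite oppr_ge0; apply: hneg => //.
      exact: bigmax_order_two pj.
    - move=> t; split => [i|]; first by rewrite tnth_mktuple node_bounds.
      (* The entry 2 at [j] makes the coordinate [j] of the sample positive, so the point is not the
         origin. *)
      have jS : j \in S by rewrite -pS inE pj.
      exists (enum_rank_in jS j); rewrite tnth_mktuple enum_rankK_in //.
      rewrite /node pj eqxx; have [_ /(_ t) /andP[tj _]] := ntau j.
      by rewrite gt_eqF.
  exists nu; split => // x xc; rewrite /Rintegral nuE; first last.
  - by move=> t; apply: prodr_ge0 => i _; rewrite le_max lexx orbT.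
  - exact: measurable_hinge_product.
  rewrite big_filter big_enum_cond /= -sumrN.
  rewrite (eq_bigr (fun p => (- term p x)%:E)); last first.
    move=> p /andP[/eqP pS _].
    have -> : - term p x = \int[mu]_t (-1 * expansion_term tau f (enum 'I_d) x
      p t).
      by rewrite RintegralZl ?mulN1r //; apply:
        bounded_measurable_integrable => //; exact: bterm.
    rewrite EFin_Rintegral_bounded; last first.
      by apply: bounded_measurableM; [exact: bounded_measurable_cst|exact:
        bterm].
    apply: eq_integral => t _; congr (_%:E).
    rewrite (hinge_product_node _ _ _ pS) /w /expansion_term node_point_enum.
    by rewrite mulrN mulN1r.
  by rewrite sumEFin.
pose nu S := sval (cid (ex_nu S)).
have nuP S := svalP (cid (ex_nu S)).
have VE S x : unit_cube x -> V S x = beta S * \prod_(j in S) x ord0 j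
    - \int[nu S]_(t in @punctured_cube R #|S|) hinge_product x t.
  move=> xc; rewrite (nuP S).2 // opprK /V (bigD1 (indicator_order S)) /=.
    by rewrite term1.
  by rewrite order_supp_indicator.
(* Components of support larger than [r] drop out. The empty support carries only the zero order, so
   its component is the constant [beta0]. *)
have key r : (forall S : {set 'I_d}, (r < #|S|)%N ->
    forall x, unit_cube x -> V S x = 0) -> F_TC r f.
  move=> Vr; exists (beta finset.set0), beta, nu; split => [S|x xc].
    exact: (nuP S).1.
  rewrite fV // -addrA -sumrB (bigD1 finset.set0) //=; congr (_ + _).
    rewrite /V (big_pred1 (indicator_order finset.set0)) => [|p].
      by rewrite term1 // big_set0 mulr1.
    apply/eqP/eqP => [pS|->]; last by rewrite order_supp_indicator.
    apply/eqP; apply: contraT; rewrite -pS => /order_twoP [j pj].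
    have : j \in order_supp p by rewrite inE pj.
    by rewrite pS finset.in_set0.
  rewrite big_mkcond [RHS]big_mkcond; apply: eq_bigr => S _.
  rewrite card_gt0; case: eqP => //= _.
  case: leqP => [_|rS]; first exact: VE.
  exact: Vr.
split.
  apply: key => S dS; have := max_card (mem S).
  by rewrite card_ord leqNgt dS.
move=> hzero; apply: key => S sS.
(* The list enumerates [S] without repetition, and its iterated derivative is the one of order 1_S,
   whose entries sum to the cardinality of [S], more than [s]. *)
apply: (anchored_component_eq0 Vloc V0 fV (js := directions (indicator_order
  S))).
- by rewrite directions_indicator filter_uniq // enum_uniq.
- by move=> j; rewrite directions_indicator mem_filter mem_enum inE andbT.
- exact: (hf _).1.
- apply: hzero => [j|]; first by rewrite indicator_orderE; case: (j \in S).
  under eq_bigr do rewrite indicator_orderE.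
  by rewrite -big_mkcond sum1_card.
Qed.
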